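(* The Floyd minimal set $(X,T)$ is of type AA$_c$ but not of type AA$_{cc}$, and it is tame$_{\mathbf 1}$.
   Context: The Floyd minimal set. Let $Y=\{0,1,2\}^{\mathbb N}$ be the $3$-adic adding machine, with $S\colon Y\to Y$ the addition of $(1,0,0,\dots)$ with carry to the right. (One can view $Y$ as a Cantor subset of $[0,1]$ via $a\mapsto\sum_{i\ge1}2a_i5^{-i}$.) Let $f_0(s)=s/2$, $f_1(s)=s$, $f_2(s)=(1+s)/2$ on $[0,1]$. For $a\in Y$ let $A_a=\bigcap_{n\ge1}f_{a_1}\circ\cdots\circ f_{a_n}([0,1])$, a closed interval which is non-degenerate exactly when $a_i=1$ for all but finitely many $i$. Let $X=\{(a,s):a\in Y,\ s\in A_a\}\subset Y\times[0,1]$, and let $T\colon X\to X$ be the homeomorphism which maps, for each $a$, the fiber $\{a\}\times A_a$ onto $\{Sa\}\times A_{Sa}$ by the increasing affine map (a singleton fiber going to a singleton fiber). The acting group is $\mathbb Z$, generated by $T$; the projection $\pi\colon X\to Y$ is the factor map onto the largest equicontinuous factor. Definitions. The enveloping semigroup $E(X,T)$ is the closure of $\{T^n:n\in\mathbb Z\}$ in $X^X$ with the pointwise topology. A compact metrizable system is tame$_{\mathbf 1}$ if its enveloping semigroup is first countable. For a factor map (continuous equivariant surjection) $\pi\colon X\to Y$ of minimal metrizable systems let $X_0=\{x\in X:\pi^{-1}(\pi(x))=\{x\}\}$ and $Y_0=\pi(X_0)$; $\pi$ is an almost one-to-one extension if $X_0$ is a dense $G_\delta$ in $X$. A minimal system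 $(X,T)$ is almost automorphic (AA) if there is an almost one-to-one extension $\pi\colon(X,T)\to(Y,T)$ with $(Y,T)$ equicontinuous; it is of type AA$_c$ if the corresponding set $Y\setminus Y_0$ is countable, and of type AA$_{cc}$ if $X\setminus X_0$ is countable. *)

(* Defs.v *)
From HB Require Import structures.
From mathcomp Require Import all_boot all_order all_algebra.
From mathcomp Require Import lra.
From mathcomp Require Import all_classical all_reals all_analysis.
From mathcomp Require Import borel_hierarchy.

Set Implicit Arguments.
Unset Strict Implicit.
Unset Printing Implicit Defensive.

Import Order.TTheory GRing.Theory Num.Theory.
Import numFieldNormedType.Exports.

Local Open Scope classical_set_scope.
Local Open Scope ring_scope.

(* Total; this is the inverse of [T] as soon as [T] is bijective. *)
Definition invfun (X : choiceType) (T : X -> X) (y : X) : X :=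
  xget y [set x | T x = y].

Definition ziter (X : choiceType) (T : X -> X) (n : int) : X -> X :=
  match n with
  | Posz k => iter k T
  | Negz k => iter k.+1 (invfun T)
  end.

Definition homeomorphism (X Y : topologicalType) (f : X -> Y) : Prop :=
  exists g : Y -> X,
    [/\ cancel f g, cancel g f, continuous f & continuous g].

Definition metrizable (R : realType) (X : topologicalType) : Prop :=
  exists d : X -> X -> R,
    [/\ forall x y, 0 <= d x y,
        forall x y, d x y = 0 <-> x = y,
        forall x y, d x y = d y x,
        forall x y z, d x z <= d x y + d y z &
        forall x (A : set X),
          nbhs x A <-> exists2 e, 0 < e & [set y | d x y < e] `<=` A].

Definition compact_metrizable_system (R : realType) (X : topologicalType)
    (T : X -> X) : Prop :=
  [/\ compact [set: X], metrizable R X & homeomorphism T].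

Definition minimal_system (R : realType) (X : topologicalType)
    (T : X -> X) : Prop :=
  [/\ compact_metrizable_system R T, [set: X] !=set0 &
      forall x, dense (range (fun n => ziter T n x))].

(* On a compact Hausdorff space the uniformity is determined by the topology,
   so this does not depend on the choice of a compatible metric. *)
Definition equicontinuous_system (Y : uniformType) (S : Y -> Y) : Prop :=
  forall (y : Y) (E : set (Y * Y)), entourage E ->
    \forall z \near y, forall n : int, E (ziter S n y, ziter S n z).

Definition factor_map (X Y : topologicalType) (T : X -> X) (S : Y -> Y)
    (pi : X -> Y) : Prop :=
  [/\ continuous pi, forall y, exists x, pi x = y &
      forall x, pi (T x) = S (pi x)].

Definition inj_points (X Y : Type) (pi : X -> Y) : set X :=
  [set x | pi @^-1` [set pi x] = [set x]].

Definition inj_values (X Y : Type) (pi : X -> Y) : set Y :=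
  pi @` inj_points pi.

Definition almost_one_to_one (X Y : topologicalType) (pi : X -> Y) : Prop :=
  Gdelta (inj_points pi) /\ dense (inj_points pi).

Definition AA_extension (R : realType) (X : topologicalType) (T : X -> X)
    (Y : uniformType) (S : Y -> Y) (pi : X -> Y) : Prop :=
  [/\ minimal_system R T, minimal_system R S, equicontinuous_system S,
      factor_map T S pi & almost_one_to_one pi].

Definition AA_c (R : realType) (X : topologicalType) (T : X -> X) : Prop :=
  exists (Y : uniformType) (S : Y -> Y) (pi : X -> Y),
    AA_extension R T S pi /\ countable (~` inj_values pi).

Definition AA_cc (R : realType) (X : topologicalType) (T : X -> X) : Prop :=
  exists (Y : uniformType) (S : Y -> Y) (pi : X -> Y),
    AA_extension R T S pi /\ countable (~` inj_points pi).

Definition enveloping_semigroup (X : topologicalType) (T : X -> X) :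
    set {ptws X -> X} :=
  closure (range (ziter T : int -> {ptws X -> X})).

Definition first_countable (X : topologicalType) : Prop :=
  forall x : X, exists B : set (set X),
    [/\ countable B, B `<=` nbhs x &
        forall A, nbhs x A -> exists2 U, B U & U `<=` A].

Definition tame1 (R : realType) (X : topologicalType) (T : X -> X) : Prop :=
  compact_metrizable_system R T /\
  first_countable (set_type (enveloping_semigroup T)).

(* Digits are indexed from 0. *)
Definition triadic : Type :=
  prod_topology (fun _ : nat => discrete_topology 'I_3).

HB.instance Definition _ := Choice.on triadic.
HB.instance Definition _ := Nbhs.on triadic.
HB.instance Definition _ := Topological.on triadic.
HB.instance Definition _ := Uniform.on triadic.

(* [carry a n]: adding (1, 0, 0, ...) to [a] carries a 1 into position [n]. *)
Fixpoint carry (a : triadic) (n : nat) : bool :=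
  if n is m.+1 then carry a m && (nat_of_ord (a m) == 2) else true.

Definition odometer (a : triadic) : triadic :=
  fun n => if carry a n then ordS (a n) else a n.

Section Floyd.
Variable R : realType.

Definition floyd_map (i : 'I_3) (s : R) : R :=
  match nat_of_ord i with
  | 0 => s / 2
  | 1 => s
  | _ => (1 + s) / 2
  end.

Fixpoint floyd_comp (a : triadic) (n : nat) : R -> R :=
  if n is m.+1 then floyd_comp a m \o floyd_map (a m) else id.

Definition floyd_itv (a : triadic) : set R :=
  \bigcap_(n in [set n | (0 < n)%N]) (floyd_comp a n @` `[0, 1]).

Definition floyd_set : set (triadic * R) :=
  [set x | floyd_itv x.1 x.2].

Definition floyd_min (a : triadic) : R := inf (floyd_itv a).
Definition floyd_len (a : triadic) : R := sup (floyd_itv a) - inf (floyd_itv a).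

(* On a non-degenerate fiber this is the increasing affine bijection from
   [floyd_itv a] onto [floyd_itv (odometer a)].  When [floyd_itv a] is a
   singleton, [floyd_len a = 0], the slope is 0 (as 0^-1 = 0) and the value is
   the unique point of [floyd_itv (odometer a)].  See [floyd_fiber_map_affine]
   and [floyd_fiber_map_image] below. *)
Definition floyd_fiber_map (a : triadic) (s : R) : R :=
  floyd_min (odometer a) +
  floyd_len (odometer a) / floyd_len a * (s - floyd_min a).

Lemma floyd_compE a n s :
  floyd_comp a n s = floyd_comp a n 0 + (floyd_comp a n 1 - floyd_comp a n 0) * s.
Proof.
elim: n s => [|n IHn] s /=; first by lra.
rewrite IHn [in RHS]IHn [floyd_comp a n (floyd_map (a n) 1)]IHn /floyd_map.
by case: (a n) => -[|[|i]] ilt /=; lra.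
Qed.

Lemma floyd_comp_lt a n : floyd_comp a n 0 < floyd_comp a n 1.
Proof.
elim: n => [|n IHn] /=; first by lra.
rewrite !(floyd_compE a n (floyd_map _ _)) /floyd_map.
by case: (a n) => -[|[|i]] ilt /=; lra.
Qed.

Lemma floyd_comp_nestS a n :
  floyd_comp a n 0 <= floyd_comp a n.+1 0 /\
  floyd_comp a n.+1 1 <= floyd_comp a n 1.
Proof.
have := floyd_comp_lt a n.
rewrite /= !(floyd_compE a n (floyd_map _ _)) /floyd_map.
by case: (a n) => -[|[|i]] ilt /=; split; lra.
Qed.

Lemma floyd_comp_nest a m n : (m <= n)%N ->
  floyd_comp a m 0 <= floyd_comp a n 0 /\ floyd_comp a n 1 <= floyd_comp a m 1.
Proof.
move=> /subnK <-; elim: (n - m)%N => [|k [IH1 IH2]]; first by [].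
have [H1 H2] := floyd_comp_nestS a (k + m).
by rewrite addSn; split; [exact: le_trans H1|exact: le_trans IH2].
Qed.

Lemma floyd_comp_lr a m n : floyd_comp a m 0 <= floyd_comp a n 1.
Proof.
have [mn|/ltnW nm] := leqP m n.
  by have [H _] := floyd_comp_nest a mn; rewrite (le_trans H)// ltW ?floyd_comp_lt.
have [_ H] := floyd_comp_nest a nm.
by rewrite (le_trans _ H)// ltW ?floyd_comp_lt.
Qed.

Lemma floyd_itvP a s :
  floyd_itv a s <-> forall n, floyd_comp a n 0 <= s <= floyd_comp a n 1.
Proof.
split=> [As n|As n _].
  have {As} [t /= + <-] := As n.+1 isT; rewrite in_itv/= => /andP[t0 t1].
  have [H1 H2] := floyd_comp_nestS a n; have H := floyd_comp_lt a n.+1.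
  rewrite -[_ (floyd_map _ _)]/(floyd_comp a n.+1 t) (floyd_compE a n.+1 t).
  move: H1 H2 H; set p0 := floyd_comp a n.+1 0; set p1 := floyd_comp a n.+1 1.
  move=> H1 H2 H; have D0 : 0 <= (p1 - p0) * t by apply: mulr_ge0 => //; lra.
  have D1 : (p1 - p0) * t <= p1 - p0 by apply: ler_piMr => //; lra.
  by apply/andP; split; lra.
have lt := floyd_comp_lt a n; have /andP[s0 s1] := As n.
exists ((s - floyd_comp a n 0) / (floyd_comp a n 1 - floyd_comp a n 0)).
  by rewrite /= in_itv/= divr_ge0 ?ler_pdivrMr ?mul1r; lra.
by rewrite floyd_compE mulrC divfK; lra.
Qed.

Lemma floyd_itv_neq0 a : floyd_itv a !=set0.
Proof.
pose L := range (fun n => floyd_comp a n 0).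
have L0 : L !=set0 by exists (floyd_comp a 0 0), 0%N.
exists (sup L); apply/floyd_itvP => n; apply/andP; split.
  apply: sup_upper_bound; last by exists n.
  by split=> //; exists (floyd_comp a 0 1) => _ [m _ <-]; exact: floyd_comp_lr.
by apply: ge_sup => // _ [m _ <-]; exact: floyd_comp_lr.
Qed.

Lemma floyd_itvE a : floyd_itv a = `[inf (floyd_itv a), sup (floyd_itv a)]%classic.
Proof.
have [s0 As0] := floyd_itv_neq0 a.
have hs : has_sup (floyd_itv a).
  by split; [exists s0|exists (floyd_comp a 0 1) => s /floyd_itvP/(_ 0%N)/andP[]].
have hi : has_inf (floyd_itv a).
  by split; [exists s0|exists (floyd_comp a 0 0) => s /floyd_itvP/(_ 0%N)/andP[]].
apply/seteqP; split=> s /=; rewrite in_itv/=.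
  by move=> As; rewrite sup_upper_bound// ge_inf//; case: hi.
move=> /andP[ms sM]; apply/floyd_itvP => n; apply/andP; split.
  by apply: le_trans ms; apply: lb_le_inf => [|t /floyd_itvP/(_ n)/andP[]//]; case: hi.
by apply: (le_trans sM); apply: ge_sup => [|t /floyd_itvP/(_ n)/andP[]//]; case: hs.
Qed.

Lemma floyd_len_ge0 a : 0 <= floyd_len a.
Proof.
rewrite /floyd_len subr_ge0; have [s As] := floyd_itv_neq0 a.
by move: As; rewrite {1}floyd_itvE /= in_itv/= => /andP[]; exact: le_trans.
Qed.

Lemma floyd_len_le a n : floyd_len a <= floyd_comp a n 1 - floyd_comp a n 0.
Proof.
have inA t : inf (floyd_itv a) <= t <= sup (floyd_itv a) -> floyd_itv a t.
  by move=> ht; rewrite floyd_itvE /= in_itv.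
have := floyd_len_ge0 a; rewrite /floyd_len subr_ge0 => le.
have /floyd_itvP/(_ n)/andP[H1 _] : floyd_itv a (inf (floyd_itv a)).
  by apply: inA; rewrite lexx.
have /floyd_itvP/(_ n)/andP[_ H2] : floyd_itv a (sup (floyd_itv a)).
  by apply: inA; rewrite lexx le.
by rewrite lerB.
Qed.

Lemma floyd_len_ge a e N : 0 <= e ->
  (forall n, (N <= n)%N -> e <= floyd_comp a n 1 - floyd_comp a n 0) ->
  e <= floyd_len a.
Proof.
move=> e0 He; pose L := range (fun n => floyd_comp a n 0).
have hsL : has_sup L.
  split; first by exists (floyd_comp a 0 0), 0%N.
  by exists (floyd_comp a 0 1) => _ [n _ <-]; exact: floyd_comp_lr.
have Lub n : sup L + e <= floyd_comp a n 1.
  rewrite -lerBrDr; apply: ge_sup => [|_ [m _ <-]]; first by case: hsL.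
  pose k := maxn N (maxn m n).
  have [H1 _] := @floyd_comp_nest a m k ltac:(by rewrite !leq_max leqnn orbT).
  have [_ H2] := @floyd_comp_nest a n k ltac:(by rewrite !leq_max leqnn !orbT).
  have := He k (leq_maxl _ _); lra.
have Llb n : floyd_comp a n 0 <= sup L.
  by apply: sup_upper_bound => //; exists n.
have A1 : floyd_itv a (sup L).
  by apply/floyd_itvP => n; have := Lub n; have := Llb n; lra.
have A2 : floyd_itv a (sup L + e).
  by apply/floyd_itvP => n; have := Lub n; have := Llb n; lra.
move: A1 A2; rewrite floyd_itvE /= !in_itv /= /floyd_len; lra.
Qed.

Lemma floyd_gapS a n :
  floyd_comp a n.+1 1 - floyd_comp a n.+1 0 =
  (floyd_comp a n 1 - floyd_comp a n 0) *
  (if nat_of_ord (a n) == 1%N then 1 else 2^-1).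
Proof.
rewrite /= !(floyd_compE a n (floyd_map _ _)) /floyd_map.
by case: (a n) => -[|[|i]] ilt /=; lra.
Qed.

(* [a] and [odometer a] differ in finitely many digits, unless [a] is constantly
   2 and [odometer a] constantly 0. *)
Lemma floyd_gap_odometer a : exists C N, 0 < C /\ forall n, (N <= n)%N ->
  floyd_comp (odometer a) n 1 - floyd_comp (odometer a) n 0 =
  C * (floyd_comp a n 1 - floyd_comp a n 0).
Proof.
have gap0 b n : 0 < floyd_comp b n 1 - floyd_comp b n 0.
  by rewrite subr_gt0 floyd_comp_lt.
have [allc|/existsNP[N /negP cN]] := pselect (forall n, carry a n).
  exists 1, 0%N; split => // n _; rewrite mul1r.
  elim: n => [//|n IHn]; rewrite !floyd_gapS IHn; congr (_ * _).
  have /= /andP[_ /eqP an] := allc n.+1.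
  by rewrite /odometer allc /= an.
exists ((floyd_comp (odometer a) N 1 - floyd_comp (odometer a) N 0) /
        (floyd_comp a N 1 - floyd_comp a N 0)), N.
split; first by rewrite divr_gt0.
move=> n /subnK <-; elim: (n - N)%N => [|k IHk].
  by rewrite add0n divfK ?gt_eqF.
rewrite addSn !floyd_gapS IHk mulrA; congr (_ * _).
suff /negPf ck : ~~ carry a (k + N) by rewrite /odometer ck.
by elim: {IHk} k => [//|k /negPf ck]; rewrite addSn /= ck.
Qed.

Lemma floyd_len_odometer a :
  exists2 C, 0 < C & floyd_len (odometer a) = C * floyd_len a.
Proof.
have [C [N [C0 HC]]] := floyd_gap_odometer a.
exists C => //; apply/eqP; rewrite eq_le; apply/andP; split.
  rewrite -ler_pdivrMl//; apply: (@floyd_len_ge _ _ N) => [|n Nn].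
    by rewrite mulr_ge0 ?invr_ge0 ?floyd_len_ge0 ?ltW.
  by rewrite ler_pdivrMl// -HC// floyd_len_le.
apply: (@floyd_len_ge _ _ N) => [|n Nn].
  by rewrite mulr_ge0 ?floyd_len_ge0 ?ltW.
by rewrite HC// ler_pM2l// floyd_len_le.
Qed.

Lemma floyd_fiber_map_affine a : exists c d, 0 < d /\
  forall s, floyd_itv a s -> floyd_fiber_map a s = c + d * s.
Proof.
have [C C0 HC] := floyd_len_odometer a.
have [l0|l0] := eqVneq (floyd_len a) 0.
  exists (floyd_min (odometer a) - floyd_min a), 1; split => // s.
  rewrite floyd_itvE /floyd_fiber_map /= in_itv/= l0 invr0.
  by move: l0; rewrite /floyd_len /floyd_min; lra.
exists (floyd_min (odometer a) - C * floyd_min a), C; split => // s _.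
by rewrite /floyd_fiber_map HC mulfK//; lra.
Qed.

Lemma floyd_fiber_map_image a :
  floyd_fiber_map a @` floyd_itv a = floyd_itv (odometer a).
Proof.
have [C C0 HC] := floyd_len_odometer a.
have la := floyd_len_ge0 a.
rewrite [in LHS]floyd_itvE [in RHS]floyd_itvE /floyd_fiber_map HC.
move: HC; rewrite /floyd_min /floyd_len.
set m' := inf _; set M' := sup _; set m := inf _; set M := sup _ => HC.
have E : M' = m' + C * (M - m) by lra.
rewrite {}E in HC *; rewrite /floyd_len -/M -/m in la.
have [l0|l0] := eqVneq (M - m) 0.
  rewrite l0 invr0; apply/seteqP; split=> [_ [s _ <-]|s]; rewrite /= ?in_itv/=; first by lra.
  by move=> ?; exists m; rewrite /= ?in_itv/=; lra.
apply/seteqP; split=> [_ [s /= + <-]|s] /=; rewrite !in_itv/= mulfK//.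
  move=> /andP[s0 s1].
  have H1 : 0 <= C * (s - m) by apply: mulr_ge0; lra.
  have H2 : C * (s - m) <= C * (M - m) by rewrite ler_pM2l//; lra.
  by lra.
move=> /andP[s0 s1]; exists (m + (s - m') / C); rewrite /= ?in_itv/=.
  have H1 : 0 <= (s - m') / C by apply: divr_ge0; lra.
  have H2 : (s - m') / C <= M - m by rewrite ler_pdivrMr// mulrC; lra.
  by lra.
by rewrite addrAC subrr add0r mulrC divfK ?gt_eqF//; lra.
Qed.

Definition floyd_space : topologicalType := set_type floyd_set.

Lemma floyd_set_stable (x : triadic * R) :
  floyd_set x -> floyd_set (odometer x.1, floyd_fiber_map x.1 x.2).
Proof. by move=> Ax; rewrite /floyd_set /= -floyd_fiber_map_image; exists x.2. Qed.

Definition floydT (x : floyd_space) : floyd_space :=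
  exist _ (odometer (val x).1, floyd_fiber_map (val x).1 (val x).2)
    (mem_set (floyd_set_stable (set_mem (valP x)))).

End Floyd.

(* Main.v *)
Require Import Defs.
From mathcomp Require Import all_boot all_order all_algebra.
From mathcomp Require Import zify ring lra.
From mathcomp Require Import all_classical all_reals all_analysis.
From mathcomp Require Import borel_hierarchy.

(** The projection [base] of the Floyd system onto the adding machine is the
  almost one-to-one extension.  Its non-degenerate fibers lie over the sequences
  that are eventually constantly 1 ([floyd_len_digits]), so over countably many
  points; everything else about [base] reduces to two facts: points over a
  degenerate fiber have neighbourhoods that depend on the base only
  ([nbhs_degenerate]), and appending digits 0 and 2 to a finite word shrinks the
  fibers to any prescribed height ([floyd_refine]), which gives the minimality
  of [floydT].

  The type AA_cc is excluded because no equicontinuous factor can separate two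
  points of the same fiber ([equicontinuous_factor_base]): an iterate of [floydT]
  brings that fiber close to a degenerate one, so the two images become close,
  and equicontinuity at the limit allows one to go back with the inverse iterate.
  The fiber over 1, 1, 1, ... is the whole of [0, 1], and thus consists of
  uncountably many points at which no such factor map is injective.

  For the enveloping semigroup E, no description of its elements is computed.
  Being closed in a compact product, E is compact, and a point [p] of E has a
  countable neighbourhood base as soon as it is determined within E by its values
  at countably many points ([first_countable_ptws]).  Such a set is
  [determining_set]:
  - one arbitrary point, since the elements of E induce translations on the base,
    and the image of one point fixes the translation ([enveloping_base_eq]);
  - the points of degenerate fibers that [p] sends into non-degenerate ones,
    which are countably many because [p] is injective on the base
    ([enveloping_base_inj]) and there are only countably many targets;
  - the two end points of each non-degenerate fiber, since the elements of E are
    affine on fibers ([enveloping_barycentric]).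
  A point outside the first two classes is either sent into a singleton fiber,
  where the translation alone determines the image, or lies in a non-degenerate
  fiber, where the end points do. *)

Set Implicit Arguments.
Unset Strict Implicit.
Unset Printing Implicit Defensive.

Import Order.TTheory GRing.Theory Num.Theory.
Import numFieldNormedType.Exports.

Local Open Scope classical_set_scope.
Local Open Scope ring_scope.

(** * Iterates, homeomorphisms and compactness *)

Lemma surj_inj_bijective (X Y : Type) (f : X -> Y) :
  (forall y, exists x, f x = y) -> injective f -> bijective f.
Proof.
move=> fs fi; have [g fg] := choice fs.
by exists g => // x; apply: fi; rewrite fg.
Qed.

Lemma countable_setU (U : Type) (A B : set U) :
  countable A -> countable B -> countable (A `|` B).
Proof.
move=> cA cB; rewrite -bigcup2E; apply: bigcup_countable => //.
by move=> [|[|i]] _ //=; exact: countable0.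
Qed.

Section Iterates.
Variables (X : choiceType) (T : X -> X).
Hypothesis bijT : bijective T.

Lemma invfunKr : cancel (invfun T) T.
Proof.
move=> y; have [g gK Kg] := bijT.
by have := xgetPex y (ex_intro [set x | T x = y] (g y) (Kg y)).
Qed.

Lemma invfunK : cancel T (invfun T).
Proof. by move=> x; apply: (bij_inj bijT); rewrite invfunKr. Qed.

(** The inverse counts as a generator of its own: a property of [T] alone says
  nothing about the negative iterates. *)
Lemma ziter_ind (P : (X -> X) -> Prop) :
  P id -> (forall g, P g -> P (T \o g)) ->
  (forall g, P g -> P (invfun T \o g)) -> forall n, P (ziter T n).
Proof.
move=> P0 PT PV [] n /=; first by elim: n => [|n IHn]; [exact: P0|exact: PT].
apply: (PV (iter n (invfun T))).
by elim: n => [|n IHn]; [exact: P0|exact: PV].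
Qed.

Lemma ziter_oppK m x : ziter T (- m%:Z) (iter m T x) = x.
Proof.
case: m => [//|m]; rewrite -NegzE; change (iter m.+1 (invfun T) (iter m.+1 T x) = x).
by elim: m.+1 x => [//|k IHk] x; rewrite iterSr /= invfunK IHk.
Qed.

End Iterates.

Lemma ziter_semiconj (X Y : choiceType) (T : X -> X) (S : Y -> Y) (pi : X -> Y) :
  bijective T -> bijective S -> (forall x, pi (T x) = S (pi x)) ->
  forall n x, pi (ziter T n x) = ziter S n (pi x).
Proof.
move=> bT bS H [] n x /=; first by elim: n => [//|n IHn] /=; rewrite H IHn.
suff E k : pi (iter k (invfun T) x) = iter k (invfun S) (pi x) by exact: (E n.+1).
by elim: k => [//|k IHk] /=; apply: (bij_inj bS); rewrite -H !invfunKr.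
Qed.

Lemma homeomorphism_bij (X Y : topologicalType) (f : X -> Y) :
  homeomorphism f -> bijective f.
Proof. by case=> g [fK gK _ _]; exists g. Qed.

Lemma compact_bij_homeomorphism (X Y : topologicalType) (f : X -> Y) :
  compact [set: X] -> hausdorff_space Y -> continuous f -> bijective f ->
  homeomorphism f.
Proof.
move=> cX hY cf [g fK gK]; exists g; split => //.
apply/continuous_closedP => A cA.
have -> : g @^-1` A = f @` A.
  by apply/seteqP; split=> [y Ay|_ [x Ax <-]] /=; [exists (g y)|rewrite fK].
apply: compact_closed => //; apply: continuous_compact.
  exact: continuous_subspaceT.
exact: subclosed_compact cX _.
Qed.

Lemma metrizable_hausdorff (R : realType) (X : topologicalType) :
  metrizable R X -> hausdorff_space X.
Proof.
move=> [d [d0 dE dC dT dN]] x y cxy; apply/dE.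
have := d0 x y; rewrite le_eqVlt => /orP[/eqP//|dxy].
have e0 : 0 < d x y / 2 by rewrite divr_gt0.
have Nx z : nbhs z [set w | d z w < d x y / 2] by apply/dN; exists (d x y / 2).
have [z [/= xz yz]] := cxy _ _ (Nx x) (Nx y).
by have := dT x z y; rewrite (dC z y); lra.
Qed.

Section Subtype.
Variables (X : topologicalType) (A : set X).

Lemma nbhs_set_typeP (x : A) (U : set A) :
  nbhs x U <-> exists2 V : set X, nbhs (\val x) V & \val @^-1` V `<=` U.
Proof.
split.
  case=> _ /= [[W oW <-] Wx WU]; exists W => //.
  by rewrite nbhsE; exists W.
case=> V; rewrite nbhsE => -[W [oW Wx] WV] VU.
by exists (\val @^-1` W); split => //=; [exists W|move=> y /WV /VU].
Qed.

Lemma compact_set_type : compact A -> compact [set: A].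
Proof.
move=> cA F FF _.
have FA : (\val @ F) A by apply: (@filterE _ F) => y; exact: set_valP.
have PF : ProperFilter (\val @ F) by exact: fmap_proper_filter.
have [x [Ax xF]] := cA (\val @ F) PF FA.
exists (exist _ x (mem_set Ax)); split=> // B U FB /nbhs_set_typeP[V xV VU].
have /xF : (\val @ F) (\val @` B).
  by apply: (@filterS _ F _ B) => // y By; exists y.
move=> /(_ _ xV) [_ [[y By <-] Vy]].
by exists y; split => //; apply: VU.
Qed.

End Subtype.

(** If no [U n] were contained in [A] within [E], the sets [E `&` U n `\` A] would
  generate a filter, and a cluster point of it would lie in every [closure (U n)],
  hence be [p], although the neighbourhood [A] of [p] is disjoint from all of them. *)
Lemma compact_nbhs_base (X : topologicalType) (E : set X) (p : X)
    (U : nat -> set X) :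
  compact E -> (forall m n, (m <= n)%N -> U n `<=` U m) ->
  (forall q, E q -> (forall n, closure (U n) q) -> q = p) ->
  forall A, nbhs p A -> exists n, E `&` U n `<=` A.
Proof.
move=> cE Ud Up A pA; apply: contrapT => /forallNP H.
pose F := filter_from [set: nat] (fun n => E `&` U n `&` ~` A).
have FF : ProperFilter F.
  apply: filter_from_proper => [|n _]; last first.
    apply/set0P/eqP => E0; apply: (H n) => q EUq; apply: contrapT => nA.
    by have : (E `&` U n `&` ~` A) q by []; rewrite E0.
  apply: filter_from_filter; first by exists 0%N.
  move=> m n _ _; exists (maxn m n) => // q [[Eq Uq] nAq].
  by do ![split=> //]; apply: Ud Uq; rewrite ?leq_maxl ?leq_maxr.
have FE : F E by exists 0%N => // q [[]].
have [q [Eq qF]] := cE F FF FE.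
have qp : q = p.
  apply: Up => // n B qB.
  have /qF/(_ qB) [r [Ur Br]] : F (U n) by exists n => // r [[]].
  by exists r.
rewrite qp in qF.
have /qF/(_ pA) [r [nAr /nAr]] : F (~` A) by exists 0%N => // r [].
by [].
Qed.

Lemma ptws_nbhs (X Y : topologicalType) (p : {ptws X -> Y}) x (V : set Y) :
  nbhs (p x) V -> nbhs p [set q : {ptws X -> Y} | V (q x)].
Proof. exact: (@proj_continuous X (fun=> Y) x p). Qed.

(** The sets [U n] of functions that are close to [p] at the first [n] points of
  [D] have only [p] in the intersection of their closures, and compactness turns
  this into a neighbourhood base.  The enumeration of [D] is an injection [f] into
  the natural numbers, so that [D] may be empty or finite. *)
Lemma first_countable_ptws (R : realType) (X Y : topologicalType)
    (E : set {ptws X -> Y}) :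
  compact [set: Y] -> metrizable R Y -> closed E ->
  (forall p, E p -> exists D : set X, countable D /\
     forall q, E q -> (forall x, D x -> q x = p x) -> q = p) ->
  first_countable (set_type E).
Proof.
move=> cY [d [d0 dE dC dT dN]] clE H p.
have [D [/countable_injP[f fI] Dp]] := H _ (set_valP p).
pose U n : set {ptws X -> Y} :=
  [set q | forall x, D x -> (f x <= n)%N -> d (\val p x) (q x) < n.+1%:R^-1].
have cE : compact E.
  have := @tychonoff X (fun=> Y) (fun=> setT) (fun=> cY).
  by move=> /(subclosed_compact clE); apply.
have Fp : Filter (nbhs (\val p : {ptws X -> Y})) by exact: nbhs_filter.
have Up n : nbhs (\val p) (U n).
  have ball_p x : nbhs (\val p : {ptws X -> Y})
      [set q : {ptws X -> Y} | d (\val p x) (q x) < n.+1%:R^-1].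
    apply: (ptws_nbhs (V := fun y => d (\val p x) y < n.+1%:R^-1)); apply/dN.
    by exists n.+1%:R^-1; rewrite ?invr_gt0.
  suff : forall m, nbhs (\val p : {ptws X -> Y}) [set q | forall x, D x ->
      (f x < m)%N -> d (\val p x) (q x) < n.+1%:R^-1].
    by move=> /(_ n.+1).
  elim=> [|m IHm]; first by apply: (@filterE _ _ Fp) => q x _; rewrite ltn0.
  have [[y [Dy fy]]|no] := pselect (exists y, D y /\ f y = m).
    apply: (@filterS2 _ _ Fp) IHm (ball_p y) => q qm qy x Dx.
    rewrite ltnS leq_eqVlt => /orP[/eqP fx|]; last exact: qm.
    by have -> : x = y by apply: fI; rewrite ?inE// fx.
  apply: (@filterS _ _ Fp) IHm => q qm x Dx; rewrite ltnS leq_eqVlt => /orP[/eqP fx|].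
    by case: no; exists x.
  exact: qm.
exists (range (fun n => \val @^-1` U n)); split.
- exact: sub_countable (card_image_le _ _) (countableP _).
- by move=> _ [n _ <-]; apply/nbhs_set_typeP; exists (U n).
move=> A /nbhs_set_typeP[V pV VA].
have [|||n nV] := @compact_nbhs_base _ E (\val p) U _ _ _ V pV.
- exact: cE.
- move=> m n mn q Uq x Dx fm; apply: lt_le_trans (Uq x Dx (leq_trans fm mn)) _.
  by rewrite lef_pV2 ?posrE// ler_nat.
- move=> q Eq Uq; apply: Dp => // x Dx; apply/esym/dE/eqP.
  rewrite eq_le d0 andbT leNgt; apply/negP => dpq.
  have e0 : 0 < d (\val p x) (q x) / 2 by rewrite divr_gt0.
  have [k] := ltr_add_invr e0; rewrite add0r => ke.
  have /Uq : nbhs q [set r : {ptws X -> Y} | d (q x) (r x) < d (\val p x) (q x) / 2].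
    apply: (ptws_nbhs (V := fun y => d (q x) y < d (\val p x) (q x) / 2)).
    by apply/dN; exists (d (\val p x) (q x) / 2).
  move=> /(_ (maxn k (f x))) [r [/= /(_ x Dx (leq_maxr _ _)) rp rq]].
  have kf : (maxn k (f x)).+1%:R^-1 <= k.+1%:R^-1 :> R.
    by rewrite lef_pV2 ?posrE// ler_nat ltnS leq_maxl.
  have : d (\val p x) (q x) < d (\val p x) (q x).
    rewrite [ltRHS]splitr; apply: le_lt_trans (dT _ (r x) _) _.
    apply: ltrD; last by rewrite dC; exact: rq.
    exact: lt_trans rp (le_lt_trans kf ke).
  by rewrite ltxx.
exists (\val @^-1` U n); first by exists n.
by move=> q Uq; apply: VA; apply: nV; split => //; exact: set_valP.
Qed.

(** * The triadic adding machine *)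

Definition agree (n : nat) (a b : triadic) : Prop :=
  forall i, (i < n)%N -> a i = b i.

Lemma agree_refl n a : agree n a a. Proof. by []. Qed.

Lemma agree_sym n a b : agree n a b -> agree n b a.
Proof. by move=> H i /H. Qed.

Lemma agree_trans n a b c : agree n a b -> agree n b c -> agree n a c.
Proof. by move=> H K i ni; rewrite H ?K. Qed.

Lemma agree_le m n a b : (m <= n)%N -> agree n a b -> agree m a b.
Proof. by move=> mn H i im; apply: H; exact: leq_trans mn. Qed.

Lemma agree_eq a b : (forall n, agree n a b) -> a = b.
Proof. by move=> H; apply: functional_extensionality_dep => i; exact: (H i.+1). Qed.

Lemma nbhs_triadicP (a : triadic) (A : set triadic) :
  nbhs a A <-> exists n, agree n a `<=` A.
Proof.
split=> [aA|[n nA]].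
  pose F := filter_from [set: nat] (fun n => agree n a).
  have FF : Filter F.
    apply: filter_from_filter; first by exists 0%N.
    move=> m n _ _; exists (maxn m n) => // b H.
    by split; apply: agree_le H; rewrite ?leq_maxl ?leq_maxr.
  have : F --> a.
    apply/cvg_sup => i U [_ [[W oW <-] /= Wa WU]].
    by exists i.+1 => // b H; apply: WU; rewrite /= -(H i).
  by move=> /(_ A aA) [n _ nA]; exists n.
apply: filterS nA _; elim: n => [|n IHn]; first exact: filterE.
have : nbhs a [set b | b n = a n].
  apply: (@proj_continuous nat (fun=> discrete_topology 'I_3) n a [set a n]).
  exact: discrete_set1.
apply: filterS2 IHn => b H bn i; rewrite ltnS leq_eqVlt => /orP[/eqP->//|].
exact: H.
Qed.

Lemma triadic_compact : compact [set: triadic].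
Proof.
have finT : finite_set [set: 'I_3] by exact: finite_finset.
have := @tychonoff nat (fun=> discrete_topology 'I_3) (fun=> setT)
  (fun=> @finite_compact (discrete_topology 'I_3) setT finT).
by congr compact; apply/seteqP; split.
Qed.

Section TriadicDist.
Variable R : realType.

(** This is 1 / (1 + l) for the length l of the longest common prefix, read as 0
  when l is infinite. *)
Definition triadic_dist (a b : triadic) : R :=
  inf [set k.+1%:R^-1 | k in [set k | agree k a b]].

Lemma triadic_dist_has_inf a b :
  has_inf [set (k.+1%:R^-1 : R) | k in [set k | agree k a b]].
Proof.
split; first by exists 1, 0%N => //; rewrite invr1.
by exists 0 => _ [k _ <-]; rewrite invr_ge0.
Qed.

Lemma triadic_dist_ge0 a b : 0 <= triadic_dist a b.
Proof.
apply: lb_le_inf; first exact: (triadic_dist_has_inf a b).1.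
by move=> _ [k _ <-]; rewrite invr_ge0.
Qed.

Lemma triadic_dist_lt a b n : triadic_dist a b < n.+1%:R^-1 <-> agree n.+1 a b.
Proof.
split=> [/(inf_lt (triadic_dist_has_inf a b).1)[_ [k ak <-]]|H].
  by rewrite ltf_pV2 ?posrE// ltr_nat => nk; apply: agree_le ak.
apply: (@le_lt_trans _ _ n.+2%:R^-1); last by rewrite ltf_pV2 ?posrE// ltr_nat.
by apply: ge_inf; [exact: (triadic_dist_has_inf a b).2|exists n.+1].
Qed.

Lemma triadic_distC a b : triadic_dist a b = triadic_dist b a.
Proof.
rewrite /triadic_dist; congr inf.
by apply/seteqP; split=> _ [k ak <-]; exists k => //; exact: agree_sym.
Qed.

Lemma triadic_dist_triangle a b c :
  triadic_dist a c <= triadic_dist a b + triadic_dist b c.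
Proof.
rewrite -lerBlDr; apply: lb_le_inf; first exact: (triadic_dist_has_inf a b).1.
move=> _ [k ab <-]; rewrite lerBlDr -lerBlDl.
apply: lb_le_inf; first exact: (triadic_dist_has_inf b c).1.
move=> _ [l bc <-]; rewrite lerBlDl.
apply: (@le_trans _ _ (minn k l).+1%:R^-1).
  apply: ge_inf; first exact: (triadic_dist_has_inf a c).2.
  exists (minn k l) => //.
  by apply: agree_trans (agree_le _ ab) (agree_le _ bc); rewrite ?geq_minl ?geq_minr.
by case: leqP => _; rewrite ?lerDl ?lerDr invr_ge0.
Qed.

Lemma triadic_dist_eq0 a b : triadic_dist a b = 0 <-> a = b.
Proof.
split=> [ab0|->].
  apply: agree_eq => -[//|n]; apply/triadic_dist_lt.
  by rewrite ab0 invr_gt0.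
apply/eqP; rewrite eq_le triadic_dist_ge0 andbT leNgt; apply/negP => d0.
have [n /ltW nd] := ltr_add_invr d0.
have /triadic_dist_lt/(le_lt_trans nd) := @agree_refl n.+1 b.
by rewrite add0r ltxx.
Qed.

Lemma nbhs_triadic_dist (a : triadic) (A : set triadic) :
  nbhs a A <-> exists2 e, 0 < e & [set b | triadic_dist a b < e] `<=` A.
Proof.
split=> [/nbhs_triadicP[n nA]|[e e0 eA]].
  exists n.+1%:R^-1; first by rewrite invr_gt0.
  by move=> b /triadic_dist_lt H; apply: nA; exact: agree_le H.
have [n] := ltr_add_invr e0; rewrite add0r => ne.
apply/nbhs_triadicP; exists n.+1 => b /triadic_dist_lt H.
by apply: eA; exact: lt_trans ne.
Qed.

Lemma triadic_metrizable : metrizable R triadic.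
Proof.
exists triadic_dist; split.
- exact: triadic_dist_ge0.
- exact: triadic_dist_eq0.
- exact: triadic_distC.
- by move=> a b c; exact: triadic_dist_triangle.
- exact: nbhs_triadic_dist.
Qed.

End TriadicDist.

(** Around each point some cylinder is small for the entourage, and compactness
  makes the length of the cylinder uniform. *)
Lemma triadic_entourage (E : set (triadic * triadic)) : entourage E ->
  exists n, forall a b, agree n a b -> E (a, b).
Proof.
move=> EE.
have := triadic_compact; rewrite compact_near_coveringP.
move=> /(_ nat \oo (fun n a => forall b, agree n a b -> E (a, b)) _) [].
  move=> a _.
  have /nbhs_triadicP[m mE] : nbhs a (xsection (split_ent E) a).
    by apply: nbhs_entourage; exact: entourage_split_ent.
  have /nbhs_triadicP[k kE] : nbhs a (xsection (split_ent E)^-1%relation a).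
    by apply: nbhs_entourage; apply: entourage_inv; exact: entourage_split_ent.
  exists (agree (maxn m k) a, [set n | (m <= n)%N]).
    by split; [apply/nbhs_triadicP; exists (maxn m k)|exists m].
  move=> [a' n] /= [aa' mn] b a'b.
  apply: (@subset_split_ent _ E) => //; exists a.
    by apply/set_mem/kE; apply: agree_le aa'; rewrite leq_maxr.
  apply/set_mem/mE/agree_trans; last exact: agree_le mn a'b.
  by apply: agree_le aa'; rewrite leq_maxl.
by move=> n _ /(_ n (leqnn n)) H; exists n => a b; exact: H.
Qed.

Fixpoint borrow (b : triadic) (n : nat) : bool :=
  if n is m.+1 then borrow b m && (nat_of_ord (b m) == 0)%N else true.

Definition odometer_inv (b : triadic) : triadic :=
  fun n => if borrow b n then ord_pred (b n) else b n.

Lemma odometer_invK : cancel odometer_inv odometer.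
Proof.
move=> b; have E n : carry (odometer_inv b) n = borrow b n.
  elim: n => [//|n /= ->]; rewrite /odometer_inv; case: (borrow b n) => //=.
  by case: (b n) => -[|[|[]]].
apply: functional_extensionality_dep => n; rewrite /odometer E /odometer_inv.
by case: (borrow b n) => //; rewrite ord_predK.
Qed.

Lemma odometerK : cancel odometer odometer_inv.
Proof.
move=> b; have E n : borrow (odometer b) n = carry b n.
  elim: n => [//|n /= ->]; rewrite /odometer; case: (carry b n) => //=.
  by case: (b n) => -[|[|[]]].
apply: functional_extensionality_dep => n; rewrite /odometer_inv E /odometer.
by case: (carry b n) => //; rewrite ordSK.
Qed.

Lemma odometer_bij : bijective odometer.
Proof. by exists odometer_inv; [exact: odometerK|exact: odometer_invK]. Qed.

(** The first [n] digits identify a cylinder with a residue modulo 3 ^ n, and the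
  odometer becomes the addition of 1; this is what makes the iterates of the
  odometer translations. *)
Fixpoint residue (n : nat) (a : triadic) : nat :=
  if n is m.+1 then residue m a + a m * 3 ^ m else 0.

Lemma residue_lt n a : (residue n a < 3 ^ n)%N.
Proof. by elim: n => [//|n IHn] /=; rewrite expnS; have := ltn_ord (a n); nia. Qed.

Lemma agree_residue n a b : agree n a b <-> residue n a = residue n b.
Proof.
split=> [|E i ni].
  elim: n => [//|n IHn] H /=.
  by rewrite IHn ?(H n)//; apply: agree_le H.
elim: n E ni => [//|n IHn] /= E; rewrite ltnS leq_eqVlt.
have := residue_lt n a; have := residue_lt n b => lb la.
have Ea : residue n a = residue n b.
  by have := congr1 (modn^~ (3 ^ n)%N) E; rewrite ![(_ + _ * _)%N]addnC !modnMDl !modn_small.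
move=> /orP[/eqP->|]; last exact: IHn.
apply: val_inj; move: E; rewrite Ea => /addnI /eqP.
by rewrite eqn_pmul2r ?expn_gt0// => /eqP.
Qed.

(** The carry out of the first [n] digits is exactly the overflow of the addition. *)
Lemma residue_odometer n a : residue n (odometer a) = (residue n a).+1 %[mod 3 ^ n].
Proof.
suff E : (residue n (odometer a) + carry a n * 3 ^ n = (residue n a).+1)%N.
  by rewrite -E addnC modnMDl.
elim: n => [//|n IHn] /=.
have D : (odometer a n + 3 * carry a n.+1 = a n + carry a n)%N.
  by rewrite /odometer /=; case: (carry a n); case: (a n) => -[|[|[]]].
by move: D; rewrite /= expnS; nia.
Qed.

Definition translates (n : nat) (g : triadic -> triadic) : Prop :=
  exists c, forall a, residue n (g a) = (residue n a + c)%N %[mod 3 ^ n].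

Lemma ziter_translates n m : translates n (ziter odometer m).
Proof.
apply: (ziter_ind (P := translates n)).
- by exists 0%N => a; rewrite addn0.
- move=> g [c gc]; exists c.+1 => a /=.
  by rewrite residue_odometer -addn1 -modnDml gc modnDml addn1 addnS.
- move=> g [c gc]; exists (c + (3 ^ n).-1)%N => a /=.
  rewrite addnA -modnDml -gc modnDml.
  rewrite -[in RHS](invfunKr odometer_bij (g a)).
  set b := invfun odometer (g a).
  rewrite -modnDml residue_odometer modnDml.
  by rewrite addSn -addnS prednK ?expn_gt0// modnDr.
Qed.

(** Two translations of a group that coincide at one point coincide everywhere;
  here the group is that of the residues modulo 3 ^ n. *)
Lemma agree_translates n g h : translates n g -> translates n h ->
  forall a b, agree n (g a) (h a) <-> agree n (g b) (h b).
Proof.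
move=> [c gc] [d hd].
have E a : agree n (g a) (h a) <-> c = d %[mod 3 ^ n].
  rewrite agree_residue -[residue n (g a)](modn_small (residue_lt n _)).
  rewrite -[residue n (h a)](modn_small (residue_lt n _)) gc hd.
  split=> [/eqP|/eqP H]; first by rewrite eqn_modDl => /eqP.
  by apply/eqP; rewrite eqn_modDl.
by move=> a b; rewrite !E.
Qed.

Lemma translates_agree n g : translates n g ->
  forall a b, agree n (g a) (g b) <-> agree n a b.
Proof.
move=> [c gc] a b; rewrite 2!agree_residue.
rewrite -[residue n (g a)](modn_small (residue_lt n _)).
rewrite -[residue n (g b)](modn_small (residue_lt n _)) !gc.
split=> [/eqP|-> //]; rewrite eqn_modDr => /eqP.
by rewrite !modn_small ?residue_lt.
Qed.

Lemma odometer_approx n a b : exists m, agree n (iter m odometer a) b.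
Proof.
have E m : residue n (iter m odometer a) = (residue n a + m)%N %[mod 3 ^ n].
  elim: m => [|m IHm] /=; first by rewrite addn0.
  by rewrite residue_odometer -addn1 -modnDml IHm modnDml addn1 addnS.
exists (residue n b + (3 ^ n - residue n a))%N; apply/agree_residue.
rewrite -[LHS](modn_small (residue_lt n _)) E.
have la := residue_lt n a.
rewrite (_ : _ + _ = residue n b + 3 ^ n)%N; last by lia.
by rewrite modnDr modn_small ?residue_lt.
Qed.

Lemma odometer_agree n a b : agree n a b -> agree n (odometer a) (odometer b).
Proof. by have /translates_agree/(_ a b)[] := ziter_translates n 1. Qed.

Lemma odometer_continuous : continuous odometer.
Proof.
move=> a A /nbhs_triadicP[n nA]; apply/nbhs_triadicP; exists n => b ab.
by apply: nA; exact: odometer_agree.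
Qed.

Lemma odometer_equicontinuous : equicontinuous_system odometer.
Proof.
move=> a E /triadic_entourage[n nE]; apply/nbhs_triadicP; exists n => b ab m.
by apply: nE; apply/(translates_agree (ziter_translates n m)).
Qed.

(** * Fibers and the local form of the fiber maps *)

Section Geometry.
Variable R : realType.
Implicit Types (a b c : triadic) (s t : R).

Lemma halfX_small (e : R) : 0 < e -> exists k, 2^-1 ^+ k < e.
Proof.
move=> /ltr_add_invr[k]; rewrite add0r => ke; exists k.+1; apply: le_lt_trans ke.
by rewrite exprVn lef_pV2 ?posrE ?exprn_gt0// -natrX ler_nat ltnW// ltn_expl.
Qed.

Lemma floyd_comp_agree n a b s : agree n a b -> floyd_comp a n s = floyd_comp b n s.
Proof.
elim: n s => [//|n IHn] s ab /=.
by rewrite (ab n)// IHn//; apply: agree_le ab.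
Qed.

Definition floyd_gap a n : R := floyd_comp a n 1 - floyd_comp a n 0.

Lemma floyd_gap_gt0 a n : 0 < floyd_gap a n.
Proof. by rewrite subr_gt0 floyd_comp_lt. Qed.

Lemma floyd_gap_le a m n : (m <= n)%N -> floyd_gap a n <= floyd_gap a m.
Proof. by move=> /(floyd_comp_nest R a)[]; rewrite /floyd_gap; lra. Qed.

Lemma floyd_gap_agree n a b : agree n a b -> floyd_gap a n = floyd_gap b n.
Proof. by move=> ab; rewrite /floyd_gap !(floyd_comp_agree _ ab). Qed.

Lemma floyd_itv_gap a b n s t : agree n a b -> floyd_itv b s ->
  floyd_comp a n 0 <= t <= floyd_comp a n 1 -> `|t - s| <= floyd_gap a n.
Proof.
move=> ab /floyd_itvP/(_ n); rewrite -!(floyd_comp_agree _ ab) /floyd_gap.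
by move=> H K; rewrite ler_norml; lra.
Qed.

Lemma floyd_len_eq0P a :
  floyd_len R a = 0 <-> forall e, 0 < e -> exists n, floyd_gap a n < e.
Proof.
split=> [l0 e e0|H].
  apply: contrapT => /forallNP H.
  have : e <= floyd_len R a.
    apply: (@floyd_len_ge R a e 0%N) => [|n _]; first exact: ltW.
    by have /negP := H n; rewrite -leNgt.
  by rewrite l0 leNgt e0.
apply/eqP; rewrite eq_le floyd_len_ge0 andbT leNgt; apply/negP => l0.
have [n] := H _ l0; rewrite ltNge => /negP; apply; exact: floyd_len_le.
Qed.

Lemma floyd_itv_min a : floyd_itv a (floyd_min R a).
Proof. by rewrite floyd_itvE /= in_itv /= lexx; have := floyd_len_ge0 R a; rewrite subr_ge0. Qed.

Lemma floyd_itv_max a : floyd_itv a (floyd_min R a + floyd_len R a).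
Proof.
have := floyd_len_ge0 R a; rewrite floyd_itvE /= in_itv /= /floyd_len /floyd_min.
by move=> H; apply/andP; lra.
Qed.

Lemma floyd_itv_bounds a s : floyd_itv a s ->
  floyd_min R a <= s <= floyd_min R a + floyd_len R a.
Proof. by rewrite floyd_itvE /= in_itv /= /floyd_len /floyd_min; lra. Qed.

Lemma floyd_itv_singleton a s t :
  floyd_len R a = 0 -> floyd_itv a s -> floyd_itv a t -> s = t.
Proof. by move=> l0 /floyd_itv_bounds + /floyd_itv_bounds; rewrite l0; lra. Qed.

Lemma carry_agree n a b : agree n a b -> carry a n = carry b n.
Proof.
elim: n => [//|n IHn] ab /=.
by rewrite (ab n)// IHn//; apply: agree_le ab.
Qed.

Lemma floyd_len_carry a : (forall n, carry a n) -> floyd_len R a = 0.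
Proof.
move=> ca; apply/floyd_len_eq0P => e /halfX_small[k ke]; exists k.
apply: le_lt_trans ke; elim: k => [|k IHk]; first by rewrite /floyd_gap /=; lra.
rewrite /floyd_gap floyd_gapS.
have /= /andP[_ /eqP->] /= := ca k.+1.
by rewrite exprSr ler_pM2r// invr_gt0.
Qed.

(** The composition of [floyd_comp (odometer a) n] with the inverse of
  [floyd_comp a n].  It depends on the first [n] digits of [a] only, and agrees
  with the fiber map once the carry has stopped, whence the continuity of
  [floydT]. *)
Definition floyd_transfer a n (s : R) : R :=
  floyd_comp (odometer a) n 0 +
  floyd_gap (odometer a) n / floyd_gap a n * (s - floyd_comp a n 0).

(** Once the carry has stopped, [a] and [odometer a] have the same digits, so that
  the two nested sequences of intervals continue with the same maps. *)
Lemma floyd_transfer_comp a n k s : ~~ carry a n ->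
  floyd_comp (odometer a) (n + k) s = floyd_transfer a n (floyd_comp a (n + k) s).
Proof.
move=> nc; have nck : ~~ carry a (n + k).
  by elim: k => [|k IHk]; rewrite ?addn0// addnS /= (negPf IHk).
elim: k s nck => [|k IHk] s.
  rewrite addn0 /floyd_transfer => _.
  rewrite floyd_compE (floyd_compE a) /floyd_gap.
  have := floyd_gap_gt0 a n; rewrite /floyd_gap => g0.
  by field; rewrite gt_eqF.
rewrite addnS /= negb_and => nck.
have nck' : ~~ carry a (n + k).
  by elim: {IHk nck} k => [|k IHk]; rewrite ?addn0// addnS /= (negPf IHk).
by rewrite IHk// /odometer (negPf nck').
Qed.

Lemma floyd_transfer_le a n s t :
  (floyd_transfer a n s <= floyd_transfer a n t) = (s <= t).
Proof.
by rewrite /floyd_transfer lerD2l ler_pM2l ?divr_gt0 ?floyd_gap_gt0// lerD2r.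
Qed.

Lemma floyd_transfer_itv a n s : ~~ carry a n ->
  floyd_itv a s <-> floyd_itv (odometer a) (floyd_transfer a n s).
Proof.
move=> nc; rewrite !floyd_itvP.
have E k : (floyd_comp (odometer a) (n + k) 0 <= floyd_transfer a n s <=
    floyd_comp (odometer a) (n + k) 1) =
    (floyd_comp a (n + k) 0 <= s <= floyd_comp a (n + k) 1).
  by rewrite !floyd_transfer_comp// !floyd_transfer_le.
split=> H m.
  have := H (n + m)%N; rewrite -E.
  by have [H1 H2] := floyd_comp_nest R (odometer a) (leq_addl n m); lra.
have := H (n + m)%N; rewrite E.
by have [H1 H2] := floyd_comp_nest R a (leq_addl n m); lra.
Qed.

Lemma floyd_transfer_onto a n t : exists s, floyd_transfer a n s = t.
Proof.
exists (floyd_comp a n 0 +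
  floyd_gap a n / floyd_gap (odometer a) n * (t - floyd_comp (odometer a) n 0)).
have := floyd_gap_gt0 a n; have := floyd_gap_gt0 (odometer a) n.
by rewrite /floyd_transfer => g0 g1; field; rewrite !gt_eqF.
Qed.

(** The transfer is an increasing affine bijection between the two fibers, so it
  matches their end points, which determine [floyd_fiber_map]. *)
Lemma floyd_fiber_mapE a n s : ~~ carry a n -> floyd_itv a s ->
  floyd_fiber_map a s = floyd_transfer a n s.
Proof.
move=> nc As; have tP := floyd_transfer_itv _ nc.
have Emin : floyd_transfer a n (floyd_min R a) = floyd_min R (odometer a).
  apply/eqP; rewrite eq_le; apply/andP; split.
    have [u uE] := floyd_transfer_onto a n (floyd_min R (odometer a)).
    rewrite -uE floyd_transfer_le.
    have /floyd_itv_bounds/andP[//] : floyd_itv a u.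
    by apply/tP; rewrite uE; exact: floyd_itv_min.
  by have /floyd_itv_bounds/andP[] := (tP _).1 (floyd_itv_min a).
pose sup' b := floyd_min R b + floyd_len R b.
have Emax : floyd_transfer a n (sup' a) = sup' (odometer a).
  apply/eqP; rewrite eq_le; apply/andP; split.
    by have /floyd_itv_bounds/andP[] := (tP _).1 (floyd_itv_max a).
  have [u uE] := floyd_transfer_onto a n (sup' (odometer a)).
  rewrite -uE floyd_transfer_le.
  have /floyd_itv_bounds/andP[//] : floyd_itv a u.
  by apply/tP; rewrite uE; exact: floyd_itv_max.
rewrite /floyd_fiber_map -Emin; have [l0|l0] := eqVneq (floyd_len R a) 0.
  rewrite l0 invr0 mulr0 mul0r addr0.
  by rewrite (floyd_itv_singleton l0 As (floyd_itv_min a)).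
have -> : floyd_len R (odometer a) =
    floyd_gap (odometer a) n / floyd_gap a n * floyd_len R a.
  move: Emin Emax; rewrite /sup' /floyd_transfer; lra.
by rewrite mulfK// /floyd_transfer; ring.
Qed.

(** The maps of the digits 0 and 2 cover [0, 1] by its two halves: choosing at
  each step the half that contains [t], one traps [t] in intervals whose lengths
  are halved. *)
Lemma floyd_refine b t n k : floyd_comp b n 0 <= t <= floyd_comp b n 1 ->
  exists c, [/\ agree n b c, floyd_comp c (n + k) 0 <= t <= floyd_comp c (n + k) 1 &
    floyd_gap c (n + k) <= 2^-1 ^+ k].
Proof.
move=> bt; elim: k => [|k [c [bc ct cg]]].
  exists b; rewrite addn0; split => //.
  by apply: le_trans (floyd_gap_le b (leq0n n)) _; rewrite /floyd_gap /=; lra.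
pose m := (n + k)%N.
pose d : 'I_3 := if t <= floyd_comp c m (1 / 2) then ord0 else ord_max.
pose c' : triadic := fun i => if i == m then d else c i.
have cc' : agree m c c' by move=> i im; rewrite /c' ltn_eqF.
exists c'; rewrite addnS; split.
- by apply: agree_trans bc (agree_le _ cc'); rewrite leq_addr.
- move: ct; rewrite /= -!(floyd_comp_agree _ cc') /c' eqxx.
  rewrite /d -/m; case: ifPn => [|] H; rewrite /floyd_map /=.
    by rewrite mul0r; lra.
  rewrite addr0 -ltNge in H *; rewrite (_ : (1 + 1) / 2 = 1); last by lra.
  by move: H; lra.
- rewrite /floyd_gap floyd_gapS exprSr.
  have -> : (nat_of_ord (c' m) == 1%N) = false.
    by rewrite /c' eqxx /d; case: ifP.
  by rewrite ler_pM2r ?invr_gt0// -/(floyd_gap c' m) -(floyd_gap_agree cc').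
Qed.

(** Each digit other than 1 halves the interval. *)
Lemma floyd_len_digits a :
  floyd_len R a != 0 -> exists N, forall n, (N <= n)%N -> nat_of_ord (a n) = 1%N.
Proof.
move=> /eqP l0; apply: contrapT => /forallNP H; apply: l0.
apply/floyd_len_eq0P => e /halfX_small[k ke].
suff [n nk] : exists n, floyd_gap a n <= 2^-1 ^+ k by exists n; exact: le_lt_trans ke.
elim: {ke} k => [|k [n nk]]; first by exists 0%N; rewrite /floyd_gap /=; lra.
have /existsNP[m /not_implyP[nm am]] := H n; exists m.+1.
rewrite /floyd_gap floyd_gapS exprSr; case: eqP => // _.
rewrite ler_pM2r ?invr_gt0//; apply: le_trans nk; exact: floyd_gap_le.
Qed.

Lemma countable_floyd_len : countable [set a | floyd_len R a != 0].
Proof.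
(* The default digit 1 turns a finite word into an eventually 1 sequence. *)
pose f (s : seq 'I_3) : triadic := fun n => nth (Ordinal (isT : 1 < 3)%N) s n.
apply: (@sub_countable _ _ _ (range f)); last first.
  exact: sub_countable (card_image_le _ _) (countableP _).
apply: subset_card_le => a /floyd_len_digits[N aN]; exists (mkseq a N) => //.
apply: functional_extensionality_dep => n; rewrite /f.
have [nN|Nn] := ltnP n N; first by rewrite nth_mkseq.
by rewrite nth_default ?size_mkseq//; apply: val_inj; rewrite /= aN.
Qed.

End Geometry.

(** * The Floyd system as an almost one-to-one extension *)

Section Space.
Variable R : realType.
Local Notation X := (floyd_space R).
Local Notation T := (@floydT R).
Implicit Types (x y z : floyd_space R).

Definition base x : triadic := (\val x).1.
Definition height x : R := (\val x).2.

Lemma heightP x : floyd_itv (base x) (height x).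
Proof. exact: set_mem (valP x). Qed.

Definition floyd_point a s (As : floyd_itv (R := R) a s) : X :=
  exist _ (a, s) (mem_set (As : floyd_set (a, s))).

Lemma floyd_ext x y : base x = base y -> height x = height y -> x = y.
Proof.
case: x y => -[a s] As [[b t] Bt]; rewrite /base /height /= => ab st.
by apply: val_inj; rewrite /= ab st.
Qed.

Lemma floyd_ext0 x y : floyd_len R (base x) = 0 -> base x = base y -> x = y.
Proof.
move=> l0 xy; apply: floyd_ext => //; apply: floyd_itv_singleton l0 (heightP x) _.
by rewrite xy; exact: heightP.
Qed.

Lemma nbhs_floydP x (A : set X) :
  nbhs x A <-> exists n e, 0 < e /\
    forall y, agree n (base x) (base y) -> `|height x - height y| < e -> A y.
Proof.
rewrite nbhs_set_typeP; split.
  case=> V [[P Q] /= [/nbhs_triadicP[n nP] /nbhs_ballP[e /= e0 eQ]] PQV] VA.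
  exists n, e; split=> // y xy hxy; apply/VA/PQV; split; first exact: nP.
  exact: eQ.
case=> n [e [e0 H]].
exists (agree n (base x) `*` ball (height x) e).
  exists (agree n (base x), ball (height x) e) => //=; split.
    by apply/nbhs_triadicP; exists n.
  exact: nbhsx_ballx.
by move=> y /= [xy hxy]; exact: H.
Qed.

(** Fibers near a degenerate fiber are contained in a short interval around it,
  so that closeness of the heights is automatic. *)
Lemma nbhs_degenerate x (A : set X) : floyd_len R (base x) = 0 ->
  nbhs x A -> exists n, forall y, agree n (base x) (base y) -> A y.
Proof.
move=> /floyd_len_eq0P l0 /nbhs_floydP[n [e [e0 H]]]; have [k ke] := l0 _ e0.
exists (maxn n k) => y xy; apply: H; first by apply: agree_le xy; rewrite leq_maxl.
apply: le_lt_trans ke; apply: floyd_itv_gap (heightP y) _.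
  by apply: agree_le xy; rewrite leq_maxr.
by have /floyd_itvP := heightP x.
Qed.

Lemma base_continuous : continuous base.
Proof.
move=> x A /nbhs_triadicP[n nA]; apply/nbhs_floydP; exists n, 1; split => // y xy _.
exact: nA.
Qed.

Lemma height_continuous : continuous height.
Proof.
move=> x A /nbhs_ballP[e /= e0 eA]; apply/nbhs_floydP; exists 0%N, e; split => // y _ xy.
exact: eA.
Qed.

Lemma base_floydT x : base (T x) = odometer (base x). Proof. by []. Qed.

Lemma height_floydT x : height (T x) = floyd_fiber_map (base x) (height x).
Proof. by []. Qed.

Lemma floydT_bij : bijective T.
Proof.
apply: surj_inj_bijective => [y|x y Txy].
  have := heightP y; rewrite -[base y]odometer_invK -floyd_fiber_map_image.
  case=> s As sE; exists (floyd_point As); apply: floyd_ext => //.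
  by rewrite base_floydT /= odometer_invK.
have bxy : base x = base y.
  by apply: (bij_inj odometer_bij); rewrite -!base_floydT Txy.
apply: floyd_ext => //; have [c [d [d0 cd]]] := floyd_fiber_map_affine R (base x).
have := congr1 height Txy; rewrite !height_floydT -bxy !cd; try exact: heightP.
  by move=> /addrI /(mulfI (lt0r_neq0 d0)).
by rewrite bxy; exact: heightP.
Qed.

(** Over a degenerate fiber, where the image fiber is degenerate too, continuity
  is that of the odometer.  Over a non-degenerate fiber the digits are not all 2,
  the carry stops, and [floydT] is locally one affine map of the height. *)
Lemma floydT_continuous : continuous T.
Proof.
move=> x A; have [l0|l0] := eqVneq (floyd_len R (base x)) 0.
  have l0' : floyd_len R (base (T x)) = 0.
    by have [C _ E] := floyd_len_odometer R (base x); rewrite base_floydT E l0 mulr0.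
  move=> /(nbhs_degenerate l0')[n nA]; apply/nbhs_floydP; exists n, 1; split=> // y xy _.
  by apply: nA; exact: odometer_agree.
have /existsNP[n /negP nc] : ~ forall n, carry (base x) n.
  by move=> /(floyd_len_carry R) /eqP; rewrite (negPf l0).
move=> /nbhs_floydP[m [e [e0 H]]].
pose C := floyd_gap R (odometer (base x)) n / floyd_gap R (base x) n.
have C0 : 0 < C by rewrite divr_gt0 ?floyd_gap_gt0.
apply/nbhs_floydP; exists (maxn m n), (e / C); split; first by rewrite divr_gt0.
move=> y xy hxy; have xym : agree m (base x) (base y) by apply: agree_le xy; rewrite leq_maxl.
have xyn : agree n (base x) (base y) by apply: agree_le xy; rewrite leq_maxr.
apply: H; first exact: odometer_agree.
rewrite !height_floydT (floyd_fiber_mapE nc (heightP x)).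
rewrite (@floyd_fiber_mapE _ (base y) n); last 2 first.
- by rewrite -(carry_agree xyn).
- exact: heightP.
rewrite /floyd_transfer -(floyd_comp_agree _ (odometer_agree xyn)).
rewrite -(floyd_gap_agree _ (odometer_agree xyn)) -(floyd_gap_agree _ xyn).
rewrite -(floyd_comp_agree _ xyn) -/C.
rewrite [X in `|X|](_ : _ = C * (height x - height y)); last by ring.
by rewrite normrM gtr0_norm// mulrC -ltr_pdivlMr.
Qed.

Lemma floyd_compact : compact [set: X].
Proof.
apply: compact_set_type.
apply: (@subclosed_compact _ _ ([set: triadic] `*` `[0, 1 : R]%classic)).
- move=> [a s] cas; apply/floyd_itvP => n.
  have na : nbhs a (agree n a) by apply/nbhs_triadicP; exists n.
  rewrite 2!leNgt; apply/andP; split; apply/negP => /= H.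
    have sV : nbhs s [set t | t < floyd_comp a n 0] by exact: lt_nbhsl.
    have [[b t] [/= /floyd_itvP/(_ n) At [/= ab tn]]] :
      @floyd_set R `&` (agree n a `*` [set t | t < floyd_comp a n 0]) !=set0.
      by apply: cas; exists (agree n a, [set t | t < floyd_comp a n 0]).
    by move: At tn; rewrite /= -!(floyd_comp_agree _ ab); lra.
  have sV : nbhs s [set t | floyd_comp a n 1 < t] by exact: lt_nbhsr.
  have [[b t] [/= /floyd_itvP/(_ n) At [/= ab tn]]] :
    @floyd_set R `&` (agree n a `*` [set t | floyd_comp a n 1 < t]) !=set0.
    by apply: cas; exists (agree n a, [set t | floyd_comp a n 1 < t]).
  by move: At tn; rewrite /= -!(floyd_comp_agree _ ab); lra.
- by apply: compact_setX; [exact: triadic_compact|exact: segment_compact].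
- by move=> [a s] /floyd_itvP/(_ 0%N) /= H; split => //=; rewrite in_itv.
Qed.

Lemma floyd_metrizable : metrizable R X.
Proof.
exists (fun x y => triadic_dist R (base x) (base y) + `|height x - height y|); split.
- by move=> x y; rewrite addr_ge0 ?triadic_dist_ge0.
- move=> x y; split=> [/eqP|->]; last first.
    by rewrite subrr normr0 addr0; apply/triadic_dist_eq0.
  rewrite paddr_eq0 ?triadic_dist_ge0// normr_eq0 subr_eq0.
  by move=> /andP[/eqP/triadic_dist_eq0 ? /eqP]; exact: floyd_ext.
- by move=> x y; rewrite triadic_distC distrC.
- move=> x y z; have := triadic_dist_triangle R (base x) (base y) (base z).
  by have := ler_distD (height y) (height x) (height z); lra.
- move=> x A; rewrite nbhs_floydP; split=> [[n [e [e0 H]]]|[e e0 H]].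
    exists (Num.min e n.+1%:R^-1); first by rewrite lt_min e0 invr_gt0 ltr0n.
    move=> y /=; rewrite lt_min => /andP[H1 H2]; apply: H.
      apply: agree_le (leqnSn n) _; apply/(@triadic_dist_lt R).
      by apply: le_lt_trans H2; rewrite lerDl.
    by apply: le_lt_trans H1; rewrite lerDr triadic_dist_ge0.
  have e20 : 0 < e / 2 by rewrite divr_gt0.
  have [n nH] := (nbhs_triadicP _ _).1 ((nbhs_triadic_dist R (base x) _).2
    (ex_intro2 _ _ (e / 2) e20 (fun=> id))).
  exists n, (e / 2); split => // y /nH /= H1 H2; apply: H => /=; lra.
Qed.

Lemma floydT_homeo : homeomorphism T.
Proof.
apply: compact_bij_homeomorphism floyd_compact _ floydT_continuous floydT_bij.
exact: metrizable_hausdorff floyd_metrizable.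
Qed.

Lemma floyd_system : compact_metrizable_system R T.
Proof. by split; [exact: floyd_compact|exact: floyd_metrizable|exact: floydT_homeo]. Qed.

Lemma odometer_homeo : homeomorphism odometer.
Proof.
apply: compact_bij_homeomorphism triadic_compact _ odometer_continuous odometer_bij.
exact: metrizable_hausdorff (triadic_metrizable R).
Qed.

Lemma odometer_minimal : minimal_system R odometer.
Proof.
split; last 2 first.
- by exists (fun=> ord0).
- move=> a O [b Ob] oO.
  have /nbhs_triadicP[n nO] : nbhs b O by exact: open_nbhs_nbhs.
  have [m am] := odometer_approx n a b.
  exists (iter m odometer a); split; first by apply: nO; exact: agree_sym.
  by exists (Posz m).
- by split; [exact: triadic_compact|exact: triadic_metrizable|exact: odometer_homeo].
Qed.

Lemma base_iter n x : base (iter n T x) = iter n odometer (base x).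
Proof. by elim: n => [//|n IHn] /=; rewrite base_floydT IHn. Qed.

(** Minimality of the odometer suffices: near [y] there is a cylinder of the base
  all of whose points have heights close to that of [y], so an orbit has only to
  visit this cylinder. *)
Lemma floydT_approx x y (O : set X) : nbhs y O -> exists m, O (iter m T x).
Proof.
move=> /nbhs_floydP[n [e [e0 H]]].
have [k ke] := halfX_small e0.
have /floyd_itvP/(_ n) yn := heightP y.
have [c [yc cy cg]] := floyd_refine k yn.
have [m xm] := odometer_approx (n + k) (base x) c.
rewrite -base_iter in xm.
exists m; apply: H.
  by apply: agree_trans yc (agree_sym (agree_le _ xm)); rewrite leq_addr.
apply: le_lt_trans ke; apply: le_trans cg.
exact: floyd_itv_gap (agree_sym xm) (heightP _) cy.
Qed.

Lemma floyd_point0 : exists x : X, floyd_len R (base x) = 0.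
Proof.
have [s As] := floyd_itv_neq0 R (fun=> ord0); exists (floyd_point As).
apply/eqP; apply: contraT => /floyd_len_digits[N /(_ N (leqnn N))].
by [].
Qed.

Lemma floyd_minimal : minimal_system R T.
Proof.
split; [exact: floyd_system|by have [x _] := floyd_point0; exists x|].
move=> x O [y Oy] oO; have [m Om] := floydT_approx x (open_nbhs_nbhs (conj oO Oy)).
by exists (iter m T x); split => //; exists (Posz m).
Qed.

Lemma base_factor : factor_map T odometer base.
Proof.
split; [exact: base_continuous| |by []].
by move=> a; have [s As] := floyd_itv_neq0 R a; exists (floyd_point As).
Qed.

Lemma inj_points_base : inj_points base = [set x | floyd_len R (base x) = 0].
Proof.
apply/seteqP; split=> x /=; rewrite /inj_points /=.
  move=> E; pose p := floyd_point (floyd_itv_min R (base x)).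
  pose q := floyd_point (floyd_itv_max R (base x)).
  have : (base @^-1` [set base x]) p by [].
  have : (base @^-1` [set base x]) q by [].
  rewrite E => /= qx px; have := congr1 height (etrans qx (esym px)).
  by rewrite /height /=; lra.
move=> l0; apply/seteqP; split=> y /=; last by move->.
by move=> yx; apply/esym; exact: floyd_ext0.
Qed.

Lemma inj_values_base : ~` inj_values base = [set a | floyd_len R a != 0].
Proof.
rewrite /inj_values inj_points_base; apply/seteqP; split=> a /=.
  move=> H; apply/eqP => l0; apply: H.
  by have [_ /(_ a)[x xa] _] := base_factor; exists x; rewrite ?xa.
by move=> /eqP l0 [x + xa]; rewrite xa.
Qed.

(** A fiber is degenerate when the nested intervals become arbitrarily short, a
  countable intersection of open conditions; the orbit of a point of a degenerate
  fiber stays in degenerate fibers, which gives density. *)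
Lemma base_almost_one_to_one : almost_one_to_one base.
Proof.
rewrite /almost_one_to_one inj_points_base; split.
  exists (fun k => [set x | exists n, floyd_gap R (base x) n < k.+1%:R^-1]).
    move=> k; rewrite openE => x [n nk]; apply/nbhs_floydP; exists n, 1; split => // y xy _.
    by exists n; rewrite -(floyd_gap_agree _ xy).
  apply/seteqP; split=> x /=.
    by move=> /floyd_len_eq0P H k _; apply: H; rewrite invr_gt0.
  move=> H; apply/floyd_len_eq0P => e /ltr_add_invr[k]; rewrite add0r => ke.
  by have [n nk] := H k I; exists n; exact: lt_trans ke.
move=> O [y Oy] oO; have [x x0] := floyd_point0.
have [m Om] := floydT_approx x (open_nbhs_nbhs (conj oO Oy)).
exists (iter m T x); split => //=; elim: {Om} m => [//|m IHm] /=.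
by have [C _ E] := floyd_len_odometer R (base (iter m T x)); rewrite base_floydT E IHm mulr0.
Qed.

Lemma floyd_AA_c : AA_c R T.
Proof.
exists triadic, odometer, base; split; last first.
  by rewrite inj_values_base; exact: countable_floyd_len.
split; [exact: floyd_minimal|exact: odometer_minimal|exact: odometer_equicontinuous|
        exact: base_factor|exact: base_almost_one_to_one].
Qed.

(** * Equicontinuous factors collapse the fibers *)

(** An iterate of order [m] sends the common fiber of [x] and [y] into a
  neighbourhood of a degenerate point [z].  By equicontinuity at [pi z], going back
  by the iterate of order [- m] leaves both [pi x] and [pi y] close to one and the
  same point. *)
Lemma equicontinuous_factor_base (Y : uniformType) (S : Y -> Y) (pi : X -> Y) :
  hausdorff_space Y -> bijective S -> equicontinuous_system S ->
  factor_map T S pi -> forall x y, base x = base y -> pi x = pi y.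
Proof.
move=> hY bS eS [cpi _ piT] x y xy; apply: hY.
rewrite -closeEnbhs entourage_close => E EE.
have [z z0] := floyd_point0.
pose U := split_ent E `&` (split_ent E)^-1%relation.
have EU : entourage U.
  by apply: filterI; [|apply: entourage_inv]; exact: entourage_split_ent.
have /(nbhs_degenerate z0)[n nU] := cpi z _ (eS (pi z) U EU).
have [m xm] := odometer_approx n (base x) (base z).
have back w : base w = base x -> U (ziter S (- m%:Z) (pi z), pi w).
  move=> wx; have /= := nU (iter m T w).
  rewrite base_iter wx => /(_ (agree_sym xm) (- m%:Z)).
  rewrite (ziter_semiconj floydT_bij bS piT (Posz m)).
  by rewrite [ziter S (Posz m) _]/= ziter_oppK.
have [_ Ux] := back x erefl; have [Uy _] := back y (esym xy).
exact: entourage_split Ux Uy.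
Qed.

(** The digit 1 acts by the identity, so the fiber over 1, 1, 1, ... is [0, 1]; all
  of its points have the same image in the factor. *)
Lemma floyd_not_AA_cc : ~ AA_cc R T.
Proof.
move=> [Y [S [pi [[_ [[_ mY hS] _ _] eS fpi _] cc]]]].
have pib := equicontinuous_factor_base (metrizable_hausdorff mY)
  (homeomorphism_bij hS) eS fpi.
pose one : triadic := fun=> Ordinal (isT : 1 < 3)%N.
have oneE n (s : R) : floyd_comp one n s = s by elim: n s => [//|n IHn] s /=; rewrite IHn.
have one_itv (s : R) : `[0, 1]%classic s -> floyd_itv one s.
  by rewrite /= in_itv /= => H; apply/floyd_itvP => n; rewrite !oneE.
have I01 : countable (`[0, 1]%classic : set R).
  apply: (@sub_countable _ _ _ (height @` ~` inj_points pi)); last first.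
    exact: sub_countable (card_image_le _ _) cc.
  apply: subset_card_le => s Hs; exists (floyd_point (one_itv _ Hs)) => //.
  rewrite /= /inj_points /= => E.
  have i0 : floyd_itv one (0 : R) by apply: (one_itv); rewrite /= in_itv /= lexx ler01.
  have i1 : floyd_itv one (1 : R) by apply: (one_itv); rewrite /= in_itv /= lexx ler01.
  have H t (it : floyd_itv one t) : t = s.
    have : [set floyd_point (one_itv _ Hs)] (floyd_point it) by rewrite -E; exact: pib.
    by move=> /(congr1 height).
  by have := oner_neq0 R; rewrite (H _ i0) (H _ i1) eqxx.
have := countable_lebesgue_measure0 I01.
by rewrite lebesgue_measure_itv /= lte_fin ltr01 oppr0 adde0 => /eqP; rewrite eqe oner_eq0.
Qed.

End Space.

(** * The enveloping semigroup *)

Section Enveloping.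
Variable R : realType.
Local Notation X := (floyd_space R).
Local Notation T := (@floydT R).
Local Notation E := (enveloping_semigroup T).
Implicit Types (x y z : X) (p q : {ptws X -> X}).

Lemma base_ziter n x : base (ziter T n x) = ziter odometer n (base x).
Proof. exact: (ziter_semiconj (@floydT_bij R) odometer_bij). Qed.

Lemma enveloping_approx p x y k : E p -> exists n,
  agree k (base (p x)) (ziter odometer n (base x)) /\
  agree k (base (p y)) (ziter odometer n (base y)).
Proof.
have near z : nbhs p [set q : {ptws X -> X} | agree k (base (p z)) (base (q z))].
  apply: (ptws_nbhs (V := fun w => agree k (base (p z)) (base w))).
  by apply: base_continuous; apply/nbhs_triadicP; exists k.
move=> /(_ _ (filterI (near x) (near y)))[_ [[n _ <-] [/= px py]]].
by exists n; rewrite -!base_ziter.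
Qed.

(** The iterates act on the first [k] digits of the base as translations, and an
  element of the closure coincides with an iterate on finitely many points up to
  [k] digits. *)
Lemma enveloping_base_eq p q x y : E p -> E q ->
  base (p x) = base (q x) -> base (p y) = base (q y).
Proof.
move=> Ep Eq pqx; apply: agree_eq => k.
have [m [mx my]] := enveloping_approx x y k Ep.
have [n [nx ny]] := enveloping_approx x y k Eq.
apply: agree_trans my (agree_trans _ (agree_sym ny)).
apply/(agree_translates (ziter_translates k m) (ziter_translates k n) (base x)).
by apply: agree_trans (agree_sym mx) _; rewrite pqx.
Qed.

Lemma enveloping_base_inj p x y : E p -> base (p x) = base (p y) -> base x = base y.
Proof.
move=> Ep pxy; apply: agree_eq => k.
have [m [mx my]] := enveloping_approx x y k Ep.
apply/(translates_agree (ziter_translates k m)).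
by apply: agree_trans (agree_sym mx) _; rewrite pxy.
Qed.

(** Being affine on the fibers, in a form that passes to the inverse and to
  composites; with one ratio [t] at a time it is also a closed condition. *)
Definition barycentric (t : R) (g : X -> X) : Prop :=
  forall x y z, base x = base y -> base x = base z ->
  height z = (1 - t) * height x + t * height y ->
  [/\ base (g x) = base (g y), base (g x) = base (g z) &
      height (g z) = (1 - t) * height (g x) + t * height (g y)].

Lemma ziter_barycentric t n : barycentric t (ziter T n).
Proof.
apply: (ziter_ind (P := barycentric t)) => [//|g gt|g gt] x y z xy xz hz.
  have [gxy gxz ghz] := gt x y z xy xz hz.
  have [c [d [d0 cd]]] := floyd_fiber_map_affine R (base (g x)).
  have hT w : base (g x) = base w -> height (T w) = c + d * height w.
    by move=> xw; rewrite height_floydT -xw cd// xw; exact: heightP.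
  rewrite /= !base_floydT -gxy -gxz; split => //.
  by rewrite !hT// ghz; ring.
have [gxy gxz ghz] := gt x y z xy xz hz; rewrite /=.
have invE w : exists2 w', w = T w' & invfun T w = w'.
  by exists (invfun T w) => //; rewrite (invfunKr (@floydT_bij R)).
have [x' xE ->] := invE (g x); have [y' yE ->] := invE (g y).
have [z' zE ->] := invE (g z).
rewrite xE yE zE !base_floydT in gxy gxz ghz.
have {}gxy := bij_inj odometer_bij gxy; have {}gxz := bij_inj odometer_bij gxz.
split => //.
have [c [d [d0 cd]]] := floyd_fiber_map_affine R (base x').
have hT w : base x' = base w -> height (T w) = c + d * height w.
  by move=> xw; rewrite height_floydT -xw cd// xw; exact: heightP.
move: ghz; rewrite !hT// => H.
by apply: (mulfI (lt0r_neq0 d0)); lra.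
Qed.

Lemma enveloping_barycentric t p x y z : E p -> base x = base y -> base x = base z ->
  height z = (1 - t) * height x + t * height y ->
  height (p z) = (1 - t) * height (p x) + t * height (p y).
Proof.
move=> Ep xy xz hz.
pose h (q : {ptws X -> X}) : R :=
  height (q z) - ((1 - t) * height (q x) + t * height (q y)).
have ch w : continuous (fun q : {ptws X -> X} => height (q w)).
  move=> q; apply: (@continuous_comp _ _ _ (fun q : {ptws X -> X} => q w)).
    exact: (@proj_continuous X (fun=> X) w q).
  exact: height_continuous.
have cth : continuous h.
  move=> q; apply: (@continuousB _ _ _ (fun r : {ptws X -> X} => height (r z))).
    exact: ch.
  apply: (@continuousD _ _ _ (fun r : {ptws X -> X} => (1 - t) * height (r x))).
    by apply: (@continuousM R _ (cst (1 - t))); [exact: cst_continuous|exact: ch].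
  by apply: (@continuousM R _ (cst t)); [exact: cst_continuous|exact: ch].
have : closed (h @^-1` [set 0]).
  by apply: (@closed_comp _ _ h); [move=> q _; exact: cth|exact: closed_eq].
move=> clh; apply/eqP; rewrite -subr_eq0; apply/eqP; apply: (clh p).
apply: closure_subset Ep => _ [n _ <-].
by have [_ _ hn] := ziter_barycentric n xy xz hz; rewrite /= /h hn subrr.
Qed.

Definition fiber_min (a : triadic) : X := floyd_point (floyd_itv_min R a).
Definition fiber_max (a : triadic) : X := floyd_point (floyd_itv_max R a).

(** In the second part [p] sends a singleton fiber into an interval, so that the
  translation of the base leaves the height of the image free. *)
Definition determining_set (x0 : X) (p : {ptws X -> X}) : set X :=
  [set x0] `|`
  [set x | floyd_len R (base x) = 0 /\ floyd_len R (base (p x)) != 0] `|`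
  (fiber_min @` [set a | floyd_len R a != 0] `|`
   fiber_max @` [set a | floyd_len R a != 0]).

(** The fibers over the source of the second part are singletons, so there the
  injectivity of [p] on the base is an injectivity on points. *)
Lemma countable_determining_set x0 p : E p -> countable (determining_set x0 p).
Proof.
move=> Ep; have cL := countable_floyd_len R.
do !apply: countable_setU; first exact: countable1; last 2 first.
- exact: sub_countable (card_image_le _ _) cL.
- exact: sub_countable (card_image_le _ _) cL.
set A := [set x | _ /\ _].
have bI : {in A &, injective (fun x => base (p x))}.
  move=> x y /set_mem[x0' _] _ /= pxy; apply: floyd_ext0 => //.
  exact: enveloping_base_inj pxy.
rewrite -(eq_countable (inj_card_eq bI)); apply: sub_countable cL.
by apply: subset_card_le => _ [x [_ px] <-].
Qed.

Lemma determining_setP x0 p q : E p -> E q ->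
  (forall x, determining_set x0 p x -> q x = p x) -> q = p.
Proof.
move=> Ep Eq pq; apply: functional_extensionality_dep => x.
have bqp : base (q x) = base (p x).
  by apply: (@enveloping_base_eq q p x0 x Eq Ep); rewrite pq//; left; left.
have [l0|lpx] := eqVneq (floyd_len R (base (p x))) 0.
  by apply: floyd_ext0; rewrite bqp.
have [l0|lx] := eqVneq (floyd_len R (base x)) 0; first by apply: pq; left; right.
apply: floyd_ext => //.
(* The ratio in which [height x] divides its fiber. *)
pose t := (height x - floyd_min R (base x)) / floyd_len R (base x).
have ht : height x =
    (1 - t) * height (fiber_min (base x)) + t * height (fiber_max (base x)).
  by rewrite /t /height /=; field.
rewrite (enveloping_barycentric Eq _ _ ht)// (enveloping_barycentric Ep _ _ ht)//.
rewrite (pq (fiber_min (base x))); last by right; left; exists (base x).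
by rewrite (pq (fiber_max (base x)))//; right; right; exists (base x).
Qed.

Lemma floyd_tame1 : tame1 R T.
Proof.
split; first exact: floyd_system.
apply: (@first_countable_ptws R X X E (@floyd_compact R) (@floyd_metrizable R)).
  exact: closed_closure.
have [x0 _] := floyd_point0 R.
move=> p Ep; exists (determining_set x0 p); split.
  exact: countable_determining_set.
by move=> q Eq; exact: determining_setP.
Qed.

End Enveloping.

Theorem theorem2p5 (R : realType) :
  [/\ AA_c R (@floydT R), ~ AA_cc R (@floydT R) & tame1 R (@floydT R)].
Proof.
by split; [exact: floyd_AA_c|exact: floyd_not_AA_cc|exact: floyd_tame1].
Qed.
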